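(* Let $\Sigma,\Gamma$ be finite alphabets, $\mu,\nu$ probability distributions on them with $\mu(a)>0$ for all $a$ and $H(\mu),H(\nu)>0$. Let $\delta$ be the serial protocol, with start state $s_0$, built from restart protocols $(A_k,f_k)$, $k\ge0$, each with $A_k$ finite and each a reduction from $\mu$ to $\nu$, and let $C_k,P_k,c_k,p_k,m_k$ be as in the context. Suppose $m_n=o\big(\sum_{i=0}^{n-1}c_i\big)$. If the limit $\ell=\lim_{n\to\infty}\frac{\sum_{i=0}^np_i}{\sum_{i=0}^nc_i}$ exists, then the efficiency of $\delta$ exists and equals $\ell$; that is, $E_n\to\ell$ in probability, where $E_n(\alpha)=\frac{|\delta(s_0,\alpha_n)|}{n}\cdot\frac{H(\nu)}{H(\mu)}$.
   Context: Input streams $\alpha\in\Sigma^\omega$ have i.i.d. letters of law $\mu$; $\alpha_n$ is the length-$n$ prefix and $|\delta(s_0,\alpha_n)|$ the number of output letters produced after reading $\alpha_n$. A prefix code is a set of finite words none a proper prefix of another; exhaustive if a random stream has a prefix in it with probability 1. A restart protocol given by an exhaustive prefix code $A\subseteq\Sigma^*$ and $f:A\to\Gamma^*$ reads input until the word read is some $x\in A$, outputs $f(x)$, and restarts; it is a reduction from $\mu$ to $\nu$ if its output letters are i.i.d. with law $\nu$. The serial protocol built from $(A_k,f_k)$ runs one iteration of the $k$-th restart protocol, then one of the $(k+1)$-st, etc.: almost every stream is uniquely $\alpha=x_0x_1\cdots$ with $x_k\in A_k$, output $f_0(x_0)f_1(x_1)\cdots$, where $f_k(x_k)$ is emitted as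 soon as $x_k$ has been read. $C_k=H(\mu)|x_k|$, $P_k=H(\nu)|f_k(x_k)|$, $c_k=\mathbb{E}C_k$, $p_k=\mathbb{E}P_k$, $m_k=H(\mu)\max_{x\in A_k}|x|$. $H$ is Shannon entropy (base 2). Convergence in probability: $\Pr(|E_n-\ell|>\epsilon)\to0$ for all $\epsilon>0$. *)

(* Defs.v *)
From HB Require Import structures.
From mathcomp Require Import all_boot all_order all_algebra finmap.
From mathcomp Require Import all_classical all_reals all_analysis.

Set Implicit Arguments.
Unset Strict Implicit.
Unset Printing Implicit Defensive.

Import Order.TTheory GRing.Theory Num.Theory.
Import numFieldNormedType.Exports.

Local Open Scope fset_scope.
Local Open Scope classical_set_scope.
Local Open Scope ring_scope.

Definition is_distribution (R : realType) (T : finType) (p : T -> R) : Prop :=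
  (forall a, 0 <= p a) /\ \sum_(a : T) p a = 1.

(* Base 2; the convention 0 log 0 = 0 holds because [ln 0 = 0]. *)
Definition entropy (R : realType) (T : finType) (p : T -> R) : R :=
  - \sum_(a : T) p a * (ln (p a) / ln 2).

(* The coordinates [X ^~ n] have law [p] and are mutually independent (product
   rule over every finite set of indices), [T] being discrete. *)
Definition iid (d : measure_display) (Omega : measurableType d) (R : realType)
    (P : probability Omega R) (T : finType) (X : Omega -> nat -> T)
    (p : T -> R) : Prop :=
  [/\ forall n (B : {set T}), measurable [set w | X w n \in B],
      forall n a, P [set w | X w n = a] = (p a)%:E
    & forall (J : {fset nat}) (B : nat -> {set T}),
        P [set w | forall i, i \in J -> X w i \in B i] =
        (\prod_(i <- J) P [set w | X w i \in B i])%E].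

(* A protocol is given by its transition function [S -> Sigma -> S * Gamma^*]. *)
Fixpoint output (S Sigma Gamma : Type) (step : S -> Sigma -> S * seq Gamma)
    (s : S) (u : seq Sigma) : seq Gamma :=
  if u is a :: u' then (step s a).2 ++ output step (step s a).1 u' else [::].

(* The length-[n] prefix of a stream [a] is [mkseq a n].  The [j]-th output
   letter is [None] if fewer than [j.+1] letters are ever produced. *)
Definition output_letter (S Sigma : Type) (Gamma : choiceType)
    (step : S -> Sigma -> S * seq Gamma) (s : S) (a : nat -> Sigma) (j : nat) :
    option Gamma :=
  xget None [set o | o != None /\
                     exists n, onth (output step s (mkseq a n)) j = o].

Definition prefix_code (Sigma : finType) (A : {fset seq Sigma}) : Prop :=
  forall x y, x \in A -> y \in A -> prefix x y -> x = y.

Definition exhaustive (d : measure_display) (Omega : measurableType d)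
    (R : realType) (P : probability Omega R) (Sigma : finType)
    (alpha : Omega -> nat -> Sigma) (A : {fset seq Sigma}) : Prop :=
  P [set w | exists n, mkseq (alpha w) n \in A] = 1%E.

(* The state is the word read since the last restart, initially [[::]].  Only
   the values of [f] on [A] matter. *)
Definition restart_step (Sigma : finType) (Gamma : Type) (A : {fset seq Sigma})
    (f : seq Sigma -> seq Gamma) (w : seq Sigma) (a : Sigma) :
    seq Sigma * seq Gamma :=
  let w' := rcons w a in if w' \in A then ([::], f w') else (w', [::]).

(* [alpha] is a random stream whose letters are i.i.d. with the source law.
   The law of an output letter lives on [option Gamma] and gives mass 0 to
   [None]: almost surely the output is infinite. *)
Definition restart_reduction (d : measure_display) (Omega : measurableType d)
    (R : realType) (P : probability Omega R) (Sigma Gamma : finType)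
    (alpha : Omega -> nat -> Sigma) (nu : Gamma -> R)
    (A : {fset seq Sigma}) (f : seq Sigma -> seq Gamma) : Prop :=
  iid P (fun w => output_letter (restart_step A f) [::] (alpha w))
        (fun o : option Gamma => if o is Some b then nu b else 0).

(* State [(k, w)]: the [k]-th restart protocol is being run and has read [w]. *)
Definition serial_step (Sigma : finType) (Gamma : Type)
    (A : nat -> {fset seq Sigma}) (f : nat -> seq Sigma -> seq Gamma)
    (s : nat * seq Sigma) (a : Sigma) : (nat * seq Sigma) * seq Gamma :=
  let w := rcons s.2 a in
  if w \in A s.1 then ((s.1.+1, [::]), f s.1 w) else ((s.1, w), [::]).

Definition serial_start (Sigma : Type) : nat * seq Sigma := (0%N, [::]).

(* a = x_0 x_1 x_2 ... with x_k \in A_k *)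
Definition factorization (Sigma : finType) (A : nat -> {fset seq Sigma})
    (a : nat -> Sigma) (x : nat -> seq Sigma) : Prop :=
  [/\ forall k, x k \in A k,
      forall k, flatten (mkseq x k) = mkseq a (size (flatten (mkseq x k)))
    & forall n, exists k, (n <= size (flatten (mkseq x k)))%N].

(* The word x_k; it is a dummy value on the null set of streams that have no
   factorization. *)
Definition factor (Sigma : finType) (A : nat -> {fset seq Sigma})
    (a : nat -> Sigma) : nat -> seq Sigma :=
  xget (fun=> [::]) [set x | factorization A a x].

Definition consumption (R : realType) (Sigma : finType) (mu : Sigma -> R)
    (A : nat -> {fset seq Sigma}) (k : nat) (a : nat -> Sigma) : R :=
  entropy mu * (size (factor A a k))%:R.

Definition production (R : realType) (Sigma Gamma : finType) (nu : Gamma -> R)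
    (A : nat -> {fset seq Sigma}) (f : nat -> seq Sigma -> seq Gamma)
    (k : nat) (a : nat -> Sigma) : R :=
  entropy nu * (size (f k (factor A a k)))%:R.

Definition mean_consumption (d : measure_display) (Omega : measurableType d)
    (R : realType) (P : probability Omega R) (Sigma : finType)
    (alpha : Omega -> nat -> Sigma) (mu : Sigma -> R)
    (A : nat -> {fset seq Sigma}) (k : nat) : R :=
  fine 'E_P[fun w => consumption mu A k (alpha w)].

Definition mean_production (d : measure_display) (Omega : measurableType d)
    (R : realType) (P : probability Omega R) (Sigma Gamma : finType)
    (alpha : Omega -> nat -> Sigma) (nu : Gamma -> R)
    (A : nat -> {fset seq Sigma}) (f : nat -> seq Sigma -> seq Gamma)
    (k : nat) : R :=
  fine 'E_P[fun w => production nu A f k (alpha w)].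

Definition max_consumption (R : realType) (Sigma : finType) (mu : Sigma -> R)
    (A : nat -> {fset seq Sigma}) (k : nat) : R :=
  entropy mu * (\max_(x <- A k) size x)%:R.

Definition cvg_in_probability (d : measure_display) (Omega : measurableType d)
    (R : realType) (P : probability Omega R) (X : nat -> Omega -> R) (l : R) :
    Prop :=
  forall eps : R, 0 < eps ->
    P [set w | eps < `|X n w - l|] @[n --> \oo] --> 0%E.

Definition empirical_efficiency (R : realType) (S : Type)
    (Sigma Gamma : finType) (mu : Sigma -> R) (nu : Gamma -> R)
    (step : S -> Sigma -> S * seq Gamma) (s : S) (n : nat)
    (a : nat -> Sigma) : R :=
  (size (output step s (mkseq a n)))%:R / n%:R * (entropy nu / entropy mu).

Definition has_efficiency (d : measure_display) (Omega : measurableType d)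
    (R : realType) (P : probability Omega R) (S : Type)
    (Sigma Gamma : finType) (alpha : Omega -> nat -> Sigma)
    (mu : Sigma -> R) (nu : Gamma -> R)
    (step : S -> Sigma -> S * seq Gamma) (s : S) (l : R) : Prop :=
  cvg_in_probability P
    (fun n w => empirical_efficiency mu nu step s n (alpha w)) l.

(* Main.v *)
Require Import Defs.
From mathcomp Require Import all_boot all_order all_algebra finmap.
From mathcomp Require Import all_classical all_reals all_analysis.
From mathcomp Require Import measurable_realfun ring lra zify.

(** Since [A_k] is finite and [mu] is positive, every stream (not only almost
every one) factors as x_0 x_1 ..., and the words x_k are independent with
Pr(x_k = y) = mu(y).  The output after [y] in [A_k] starts with [f_k y], so
mu(y) <= nu(f_k y); as max nu < 1, this gives |f_k y| <= K |y| with [K]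
independent of [k].  Hence P_k <= kappa C_k, and both Var(C_0 + ... + C_{k-1})
and Var(P_0 + ... + P_{k-1}) are at most a constant times sum_i m_i c_i, which
is o((c_0 + ... + c_{k-1})^2); Chebyshev's inequality gives concentration of
both partial sums.  For given [n], choose the deterministic [k] with
c_0 + ... + c_{k-1} <= n H(mu) < c_0 + ... + c_k.  With high probability the
first [k] iterations end near time [n], and the output produced by time [n]
differs from theirs by at most [K] times the sum of the time difference and one
word length. *)

Import Order.TTheory GRing.Theory Num.Theory.
Import numFieldNormedType.Exports.

Local Open Scope fset_scope.
Local Open Scope classical_set_scope.
Local Open Scope ring_scope.

Set Implicit Arguments.
Unset Strict Implicit.
Unset Printing Implicit Defensive.

(** * Prefixes of words and streams *)

Lemma mkseq_cat {T : Type} (a : nat -> T) m n :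
  mkseq a (m + n) = mkseq a m ++ mkseq (fun i => a (m + i)%N) n.
Proof.
by rewrite /mkseq iotaD map_cat add0n -{2}[m]addn0 iotaDl -map_comp.
Qed.

Lemma prefix_mkseq {T : eqType} (a : nat -> T) m n :
  (m <= n)%N -> prefix (mkseq a m) (mkseq a n).
Proof. by move=> mn; rewrite -(subnKC mn) mkseq_cat prefix_prefix. Qed.

Lemma mkseq_prefix {T : eqType} (a : nat -> T) n u :
  prefix u (mkseq a n) -> mkseq a (size u) = u.
Proof.
move=> /[dup] /size_prefix; rewrite size_mkseq => un.
by rewrite prefixE -(subnKC un) mkseq_cat take_size_cat ?size_mkseq // => /eqP.
Qed.

Lemma mkseq_catE {T : eqType} (a : nat -> T) u v :
  mkseq a (size (u ++ v)) = u ++ v <->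
  mkseq a (size u) = u /\
  mkseq (fun i => a (size u + i)%N) (size v) = v.
Proof.
rewrite size_cat mkseq_cat; split.
- move=> /eqP; rewrite eqseq_cat ?size_mkseq // => /andP[/eqP -> /eqP ->].
  by [].
- by case=> -> ->.
Qed.

Lemma prefix_comparable {T : eqType} (u v w : seq T) :
  prefix u w -> prefix v w -> prefix u v \/ prefix v u.
Proof.
wlog uv : u v / (size u <= size v)%N => [H|] uw vw.
  case/orP: (leq_total (size u) (size v)) => h; first exact: H.
  by case: (H v u) => //; [right|left].
left; move: uw vw; rewrite !prefixE => /eqP uw /eqP vw.
by rewrite -vw take_takel // uw.
Qed.

(** * Output and state of a protocol after a finite word *)

Section Protocol.
Context {S Sigma Gamma : Type} (step : S -> Sigma -> S * seq Gamma).

Definition final_state (s : S) (u : seq Sigma) : S :=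
  foldl (fun t a => (step t a).1) s u.

Lemma output_cat s u v :
  output step s (u ++ v) = output step s u ++ output step (final_state s u) v.
Proof. by elim: u s => //= a u IH s; rewrite IH catA. Qed.

Lemma final_state_cat s u v :
  final_state s (u ++ v) = final_state (final_state s u) v.
Proof. exact: foldl_cat. Qed.
End Protocol.

(** The output on a longer prefix extends the output on a shorter one, so a letter once written
    never changes and [xget] chooses from a set with a single element. *)
Lemma output_letterE {S Sigma : Type} {Gamma : choiceType}
    (step : S -> Sigma -> S * seq Gamma) (s : S) (a : nat -> Sigma)
    n j b :
  onth (output step s (mkseq a n)) j = Some b ->
  output_letter step s a j = Some b.
Proof.
move=> nb; apply: xget_subset1; first by split=> //; exists n.
have mono m m' : (m <= m')%N -> onth (output step s (mkseq a m)) j != None ->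
    onth (output step s (mkseq a m')) j = onth (output step s (mkseq a m)) j.
  move=> mm'; rewrite -(subnKC mm') mkseq_cat output_cat onth_cat.
  by case: ltnP => // ?; rewrite onth_default.
move=> b1 b2 [ne1 [m mo]] [ne2 [m' mo']].
subst b1 b2.
by case/orP: (leq_total m m') => h; [rewrite -(mono _ _ h)|rewrite (mono _ _ h)].
Qed.

(** * Prefix codes and runs of a restart protocol *)

Section PrefixCode.
Context {Sigma : finType}.
Implicit Types (A : {fset seq Sigma}) (a : nat -> Sigma).

Lemma proper_prefix_notin A x u v : prefix_code A -> x \in A ->
  x = u ++ v -> v != [::] -> u \notin A.
Proof.
move=> pA xA xuv v0; apply/negP => uA.
have := pA u x uA xA; rewrite xuv prefix_prefix => /(_ isT) /(congr1 size).
rewrite size_cat; case: v v0 {xuv} => //= c v _ szE; lia.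
Qed.

Lemma prefix_code_nil A y : prefix_code A -> [::] \in A -> y \in A -> y = [::].
Proof. by move=> pA nA yA; apply/esym/pA; rewrite ?prefix0s. Qed.

Lemma prefix_code_eq A w x y : prefix_code A -> x \in A -> y \in A ->
  prefix x w -> prefix y w -> x = y.
Proof.
by move=> pA xA yA xw yw; case: (prefix_comparable xw yw) => h; [|symmetry];
  apply: pA.
Qed.

Section Restart.
Context {Gamma : Type} (A : {fset seq Sigma}) (f : seq Sigma -> seq Gamma).
Hypothesis A_prefix : prefix_code A.

(** No proper prefix of a code word lies in the code, so the protocol stays silent and merely stores
    the letters. *)
Lemma restart_run x u v : x \in A -> x = u ++ v -> v != [::] ->
  output (restart_step A f) [::] u = [::] /\
  final_state (restart_step A f) [::] u = u.
Proof.
move=> xA; elim/last_ind: u v => [//|u c IH] v xE v0.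
have [out st] := IH (c :: v) ltac:(by rewrite xE cat_rcons) isT.
rewrite -cats1 output_cat final_state_cat out st /= /restart_step.
by rewrite (negbTE (proper_prefix_notin A_prefix xA xE v0)) cats1.
Qed.

Lemma restart_output x : x \in A -> x != [::] ->
  output (restart_step A f) [::] x = f x.
Proof.
move=> xA; elim/last_ind: x xA => // u c _ xA _.
have [out st] := restart_run (v := [:: c]) xA (esym (cats1 u c)) isT.
by rewrite -cats1 output_cat out st /= /restart_step cats1 xA cats0.
Qed.

(** Here [A] contains only the empty word, whereas membership is tested after a letter has been
    appended; the test never succeeds. *)
Lemma restart_output_nil u : [::] \in A ->
  output (restart_step A f) [::] u = [::].
Proof.
move=> nA; suff H w : output (restart_step A f) w u = [::] by apply: H.
elim: u w => //= c u IH w; rewrite /restart_step.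
case: ifPn => [/(prefix_code_nil A_prefix nA)/(congr1 size)|_] /=.
  by rewrite size_rcons.
by rewrite IH.
Qed.
End Restart.

(** * Runs of the serial protocol *)

Section Serial.
Context {Gamma : Type} (A : nat -> {fset seq Sigma}).
Context (f : nat -> seq Sigma -> seq Gamma).
Hypothesis A_prefix : forall k, prefix_code (A k).
Hypothesis A_nonnil : forall k, [::] \notin A k.

Lemma serial_run k x u v : x \in A k -> x = u ++ v -> v != [::] ->
  output (serial_step A f) (k, [::]) u = [::] /\
  final_state (serial_step A f) (k, [::]) u = (k, u).
Proof.
move=> xA; elim/last_ind: u v => [//|u c IH] v xE v0.
have [out st] := IH (c :: v) ltac:(by rewrite xE cat_rcons) isT.
rewrite -cats1 output_cat final_state_cat out st /= /serial_step /=.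
by rewrite (negbTE (proper_prefix_notin (@A_prefix k) xA xE v0)) cats1.
Qed.

Lemma serial_iteration k x : x \in A k ->
  output (serial_step A f) (k, [::]) x = f k x /\
  final_state (serial_step A f) (k, [::]) x = (k.+1, [::]).
Proof.
move=> xA; have x0 : x != [::] by apply: contraTneq xA => ->.
elim/last_ind: x xA x0 => // u c _ xA _.
have [out st] := serial_run (v := [:: c]) xA (esym (cats1 u c)) isT.
rewrite -cats1 output_cat final_state_cat out st /= /serial_step /= !cats1 xA.
by rewrite cats0.
Qed.

Lemma serial_iterations (x : nat -> seq Sigma) k : (forall k, x k \in A k) ->
  size (output (serial_step A f) (serial_start Sigma) (flatten (mkseq x k)))
    = (\sum_(0 <= i < k) size (f i (x i)))%N /\
  final_state (serial_step A f) (serial_start Sigma) (flatten (mkseq x k))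
    = (k, [::]).
Proof.
move=> xA; elim: k => [|k [out st]]; first by rewrite big_nil.
have [ out' st'] := serial_iteration (xA k).
rewrite mkseqS flatten_rcons output_cat final_state_cat st st' out' size_cat out.
by rewrite big_nat_recr.
Qed.

Lemma size_flatten_mkseq (x : nat -> seq Sigma) k :
  size (flatten (mkseq x k)) = (\sum_(0 <= i < k) size (x i))%N.
Proof.
by elim: k => [|k IH]; rewrite ?big_nil // mkseqS flatten_rcons size_cat IH
  big_nat_recr.
Qed.

(** Each f_k(x_k) is emitted only when x_k is complete, so the output at time [n] is that of the
    iterations finished by then; [k] is the one still running. *)
Lemma serial_output_size a x n : factorization A a x ->
  exists k, [/\ (\sum_(0 <= i < k) size (x i) <= n)%N,
    (n < \sum_(0 <= i < k.+1) size (x i))%N &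
    size (output (serial_step A f) (serial_start Sigma) (mkseq a n))
      = (\sum_(0 <= i < k) size (f i (x i)))%N].
Proof.
move=> [xA xa x_unbounded].
have [m nm] := x_unbounded n.+1; rewrite size_flatten_mkseq in nm.
(* The running iteration is the first to end strictly after [n]; one ending exactly at [n] is
   already complete. *)
pose Q k := (n < \sum_(0 <= i < k.+1) size (x i))%N.
have exQ : exists k, Q k.
  exists m; apply: leq_trans nm _; rewrite big_nat_recr //=; exact: leq_addr.
case: (ex_minnP exQ) => k Qk k_min.
have kn : (\sum_(0 <= i < k) size (x i) <= n)%N.
  case: k Qk k_min => [|k] Qk k_min; first by rewrite big_nil.
  by rewrite leqNgt; apply/negP => /k_min; rewrite ltnn.
exists k; split=> //.
have [out st] := serial_iterations k xA.
have fl : mkseq a (\sum_(0 <= i < k) size (x i))%N = flatten (mkseq x k).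
  by rewrite -size_flatten_mkseq -xa.
have fl' : mkseq a (\sum_(0 <= i < k.+1) size (x i))%N
    = flatten (mkseq x k) ++ x k.
  by rewrite -size_flatten_mkseq -xa mkseqS flatten_rcons.
rewrite -(subnKC kn) mkseq_cat fl output_cat size_cat out st.
set u := mkseq _ (n - _).
(* The letters [u] read since the last restart form a proper prefix of [x k], hence produce no
   output. *)
have xE : x k = u ++ mkseq (fun i => a (n + i)%N)
    (\sum_(0 <= i < k.+1) size (x i) - n)%N.
  move/eqP: fl'; rewrite -{1}(subnKC (ltnW Qk)) mkseq_cat -{1}(subnKC kn).
  rewrite mkseq_cat fl -catA eqseq_cat // eqxx => /eqP <-; congr (_ ++ _).
have [|-> _] := serial_run (xA k) xE; last by rewrite addn0.
by rewrite -size_eq0 size_mkseq subn_eq0 -ltnNge.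
Qed.
End Serial.

(** * Factorization of streams into code words *)

Section Factorization.
Variable A : nat -> {fset seq Sigma}.
Hypothesis A_prefix : forall k, prefix_code (A k).
Hypothesis A_nonnil : forall k, [::] \notin A k.
Hypothesis A_total : forall k a, exists n, mkseq a n \in A k.

(** By induction the earlier words agree, and then the next two words are prefixes of the same
    shifted stream. Uniqueness is stated for finite lists because these describe cylinder events. *)
Lemma factorization_unique a x (ys : seq (seq Sigma)) :
  factorization A a x ->
  (forall i, (i < size ys)%N -> nth [::] ys i \in A i) ->
  mkseq a (size (flatten ys)) = flatten ys ->
  mkseq x (size ys) = ys.
Proof.
move=> [xA xa _]; elim/last_ind: ys => // ys y IH ysA.
rewrite flatten_rcons => /mkseq_catE[ysa ya].
have ysA' i : (i < size ys)%N -> nth [::] ys i \in A i.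
  by move=> iys; have := ysA i; rewrite size_rcons nth_rcons iys; apply; lia.
rewrite size_rcons mkseqS IH //; congr rcons.
have yA : y \in A (size ys).
  by have := ysA (size ys); rewrite size_rcons nth_rcons ltnn eqxx; apply; lia.
have /esym := xa (size ys).+1.
rewrite mkseqS flatten_rcons => /mkseq_catE[_].
rewrite IH // => xya.
apply: (@prefix_code_eq (A (size ys))
  (mkseq (fun i => a (size (flatten ys) + i)%N)
   (maxn (size y) (size (x (size ys)))))) => //.
- by rewrite -{1}xya prefix_mkseq // leq_maxr.
- by rewrite -{1}ya prefix_mkseq // leq_maxl.
Qed.

(** Code words are cut off greedily: by totality, one starts at every position of the stream. *)
Lemma factorization_exists a : exists x, factorization A a x.
Proof.
pose next k t := xget 0%N [set n | mkseq (fun i => a (t + i)%N) n \in A k].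
have nextA k t : mkseq (fun i => a (t + i)%N) (next k t) \in A k.
  by rewrite /next; case: xgetP => [n -> //|];
    have [n nA] := A_total k (fun i => a (t + i)%N); move=> /(_ n).
pose pos := fix pos k :=
  if k is k'.+1 then (pos k' + next k' (pos k'))%N else 0%N.
pose x k := mkseq (fun i => a (pos k + i)%N) (next k (pos k)).
have sx k : size (flatten (mkseq x k)) = pos k.
  elim: k => // k IH; rewrite mkseqS flatten_rcons size_cat IH /=.
  by rewrite size_mkseq.
exists x; split=> [k|k|n]; first exact: nextA.
  rewrite sx; elim: k => // k IH.
  by rewrite mkseqS flatten_rcons IH /= mkseq_cat.
(* Code words are nonempty, so [n] of them have total length at least [n]. *)
exists n; rewrite size_flatten_mkseq.
rewrite -[leqLHS]muln1 -[X in (X * _)%N]subn0 -sum_nat_const_nat.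
apply: leq_sum => i _; rewrite lt0n size_eq0.
by apply: contraNneq (A_nonnil i) => <-; apply: nextA.
Qed.

Lemma factor_factorization a : factorization A a (Defs.factor A a).
Proof.
by have [x xP] := factorization_exists a; exact: xgetI xP.
Qed.
End Factorization.
End PrefixCode.

(** * Finite sums over tuples of code words, and their variance *)

Definition cylinder {Omega T : Type} (X : Omega -> nat -> T) (u : seq T) :
    set Omega :=
  [set w | mkseq (X w) (size u) = u].

Definition word_mass {R : realType} {T : Type} (p : T -> R) (u : seq T) : R :=
  \prod_(a <- u) p a.

Section Words.
Context {R : realType} {Sigma : finType} (mu : Sigma -> R).
Context (A : nat -> {fset seq Sigma}).

(** The product of the first [k] codes as a finite list, so that statements about x_0, ..., x_{k-1}
    reduce to finite sums. *)
Fixpoint words (k : nat) : seq (seq (seq Sigma)) :=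
  if k is k'.+1 then [seq rcons ys y | ys <- words k', y <- A k'] else [:: [::]].

Lemma words_uniq k : uniq (words k).
Proof.
elim: k => //= k IH; apply: allpairs_uniq => //; first exact: fset_uniq.
by move=> [ys y] [zs z] _ _ /= /rcons_inj.
Qed.

Lemma mem_words k ys : reflect
  (size ys = k /\ forall i, (i < k)%N -> nth [::] ys i \in A i) (ys \in words k).
Proof.
apply: (iffP idP).
- elim: k ys => [|k IH] ys /=; first by rewrite inE => /eqP ->.
  move=> /allpairsP[[zs z] /= [/IH[sz zsA] zA ->]].
  rewrite size_rcons sz; split=> // i; rewrite nth_rcons sz ltnS leq_eqVlt.
  by case: ltngtP => //= [/zsA|->].
- elim: k ys => [|k IH] ys /= [sz ysA].
    by rewrite (size0nil sz) inE.
  elim/last_ind: ys sz ysA => // ys y _; rewrite size_rcons => -[sz] ysA.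
  apply: allpairs_f; first apply: IH.
    split=> // i ik; have := ysA i (ltnW ik).
    by rewrite nth_rcons sz ik.
  by have := ysA k (leqnn _); rewrite nth_rcons sz ltnn eqxx.
Qed.

(** This plays the role of the expectation of [h] at the tuple of the first [k] factors, and
    [mean k g] that of [g] at x_k. *)
Definition words_sum (k : nat) (h : seq (seq Sigma) -> R) : R :=
  \sum_(ys <- words k) word_mass mu (flatten ys) * h ys.

Definition mean (k : nat) (g : seq Sigma -> R) : R :=
  \sum_(y <- A k) word_mass mu y * g y.

(** Conditioning on the first [k] words: the mass of a concatenation is the product of the
    masses. *)
Lemma words_sumS k h :
  words_sum k.+1 h = words_sum k (fun ys => mean k (fun y => h (rcons ys y))).
Proof.
rewrite /words_sum /= big_allpairs_dep; apply: eq_bigr => ys _.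
rewrite mulr_sumr; apply: eq_bigr => y _.
by rewrite flatten_rcons /word_mass big_cat mulrA.
Qed.

Hypothesis mu_ge0 : forall a, 0 <= mu a.

Lemma word_mass_ge0 u : 0 <= word_mass mu u.
Proof. by apply: prodr_ge0. Qed.

Lemma words_sumD k h h' :
  words_sum k (fun ys => h ys + h' ys) = words_sum k h + words_sum k h'.
Proof.
by rewrite /words_sum -big_split; apply: eq_bigr => ys _; rewrite mulrDr.
Qed.

Lemma words_sum_le k h h' : (forall ys, ys \in words k -> h ys <= h' ys) ->
  words_sum k h <= words_sum k h'.
Proof.
move=> hh'; rewrite /words_sum big_seq [leRHS]big_seq; apply: ler_sum => ys ysk.
by rewrite ler_wpM2l ?word_mass_ge0 // hh'.
Qed.

Lemma mean_le k g g' : (forall y, y \in A k -> g y <= g' y) ->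
  mean k g <= mean k g'.
Proof.
move=> gg'; rewrite /mean big_seq [leRHS]big_seq; apply: ler_sum => y yA.
by rewrite ler_wpM2l ?word_mass_ge0 // gg'.
Qed.

Lemma meanZ k c g : mean k (fun y => c * g y) = c * mean k g.
Proof. by rewrite /mean mulr_sumr; apply: eq_bigr => y _; rewrite mulrCA. Qed.

Lemma meanD k g g' : mean k (fun y => g y + g' y) = mean k g + mean k g'.
Proof. by rewrite /mean -big_split; apply: eq_bigr => y _; rewrite mulrDr. Qed.

Hypothesis A_mass : forall k, \sum_(y <- A k) word_mass mu y = 1.

Lemma mean_cst k c : mean k (fun=> c) = c.
Proof. by rewrite /mean -mulr_suml A_mass mul1r. Qed.

Lemma words_sum_cst k c : words_sum k (fun=> c) = c.
Proof.
elim: k => [|k IH].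
  by rewrite /words_sum big_seq1 /= /word_mass big_nil mul1r.
rewrite words_sumS -[RHS]IH; congr words_sum.
by apply: funext => ?; rewrite mean_cst.
Qed.

Definition deviation (g : nat -> seq Sigma -> R) k (ys : seq (seq Sigma)) : R :=
  \sum_(0 <= i < k) (g i (nth [::] ys i) - mean i (g i)).

(* The deviations form a martingale, so their increments are orthogonal. *)
Lemma words_sum_deviation2 g k :
  words_sum k (fun ys => deviation g k ys ^+ 2) <=
  \sum_(0 <= i < k) mean i (fun y => g i y ^+ 2).
Proof.
elim: k => [|k IH].
  by rewrite /words_sum big_seq1 /deviation !big_nil expr0n mulr0.
rewrite words_sumS big_nat_recr //=; set v := mean k _.
rewrite -[v](words_sum_cst k).
apply: le_trans (lerD IH (lexx _)).
rewrite -words_sumD; apply: words_sum_le => ys /mem_words[sz _].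
have devS y : deviation g k.+1 (rcons ys y)
    = deviation g k ys + (g k y - mean k (g k)).
  rewrite /deviation big_nat_recr //= nth_rcons sz ltnn eqxx; congr (_ + _).
  by apply: eq_big_nat => i /andP[_ ik]; rewrite nth_rcons sz ik.
set D := deviation g k ys in devS *; set m := mean k (g k) in devS *.
(* Averaging over [y] gives [v + D ^+ 2 - m ^+ 2]: the cross terms with [D] cancel, and the negative
   square is dropped. *)
have -> : (fun y => deviation g k.+1 (rcons ys y) ^+ 2) =
    (fun y => g k y ^+ 2 + (2 * (D - m) * g k y + (D - m) ^+ 2)).
  by apply: funext => y; rewrite devS; ring.
rewrite meanD meanD meanZ mean_cst -/m -/v.
by have := sqr_ge0 m; lra.
Qed.

Lemma words_chebyshev (g : nat -> seq Sigma -> R) k (t : R) : 0 < t ->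
  words_sum k (fun ys => (t < `|deviation g k ys|)%R%:R) <=
  (\sum_(0 <= i < k) mean i (fun y => g i y ^+ 2)) / t ^+ 2.
Proof.
move=> t0; rewrite ler_pdivlMr ?exprn_gt0 //.
apply: le_trans (words_sum_deviation2 g k).
rewrite /words_sum mulr_suml; apply: ler_sum => ys _.
rewrite -mulrA ler_wpM2l ?word_mass_ge0 //.
case: ltP => h; last by rewrite mul0r sqr_ge0.
rewrite mul1r -[leRHS]real_normK ?num_real // ler_sqr ?nnegrE ?(ltW t0) //.
exact: ltW.
Qed.
End Words.

(** * Probabilities of finite unions and of cylinders *)

Section Measure.
Context {d : measure_display} {Omega : measurableType d} {R : realType}.
Context (P : probability Omega R).

Lemma finite_union_set (I : choiceType) (s : seq I) (F : I -> set Omega) :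
  [set w | exists2 i, i \in s & F i w] = \big[setU/set0]_(i <- s) F i.
Proof. by rewrite -bigcup_seq. Qed.

Lemma probability_finite_union (I : choiceType) (s : seq I) (F : I -> set Omega) :
  uniq s -> (forall i, measurable (F i)) ->
  (forall i j w, i \in s -> j \in s -> F i w -> F j w -> i = j) ->
  P [set w | exists2 i, i \in s & F i w] = (\sum_(i <- s) P (F i))%E.
Proof.
move=> us mF dF; rewrite finite_union_set.
elim: s us dF => [|i s IH] /= us dF; first by rewrite !big_nil measure0.
move/andP: us => [is_ us]; rewrite !big_cons -IH //; last first.
  by move=> j k w js ks; apply: dF; rewrite inE ?js ?ks orbT.
apply: measureU => //; first exact: bigsetU_measurable.
rewrite -subset0 => w [Fi]; rewrite -finite_union_set => -[j js Fj].
by move: is_; rewrite (dF i j w) ?js ?inE ?eqxx ?js ?orbT.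
Qed.

Section Iid.
Context {T : finType} (X : Omega -> nat -> T) (p : T -> R).
Hypothesis X_iid : iid P X p.

Lemma measurable_cylinder u : measurable (cylinder X u).
Proof.
have [mX _ _] := X_iid.
elim/last_ind: u => [|u c IH].
  by rewrite [cylinder X _](_ : _ = setT) //; apply/seteqP; split.
rewrite [cylinder X _](_ : _ =
    cylinder X u `&` [set w | X w (size u) \in [set c]%SET]).
  exact: measurableI.
rewrite /cylinder size_rcons; apply/seteqP; split=> w /=.
- rewrite mkseqS => /rcons_inj[-> ->]; split=> //; exact/set1P.
- by rewrite mkseqS => -[-> /set1P ->].
Qed.

(** There are finitely many words of length [n], so the event is a finite union of cylinders. *)
Lemma measurable_prefix_event n (Q : pred (seq T)) :
  measurable [set w | Q (mkseq (X w) n)].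
Proof.
rewrite [X in measurable X](_ : _ = [set w | exists2 u : n.-tuple T,
  u \in [seq u : n.-tuple T <- enum {: n.-tuple T} | Q u] & cylinder X u w]).
  by rewrite finite_union_set; apply: bigsetU_measurable => u _;
    apply: measurable_cylinder.
apply/seteqP; split=> w /=.
- move=> Qw; have sz : size (mkseq (X w) n) == n by rewrite size_mkseq.
  exists (Tuple sz); first by rewrite mem_filter mem_enum /= Qw.
  by rewrite /cylinder /= size_mkseq.
- move=> [u]; rewrite mem_filter => /andP[Qu _].
  by rewrite /cylinder /= size_tuple => ->.
Qed.

(** The product rule is applied to singletons at the indices below the length of [u]. *)
Lemma probability_cylinder u : P (cylinder X u) = (word_mass p u)%:E.
Proof.
have [_ pX iX] := X_iid.
(* The empty word is split off because [nth] needs a default letter. *)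
case: u => [|c u].
  rewrite /word_mass big_nil [cylinder X _](_ : _ = setT) ?probability_setT //.
  by apply/seteqP; split.
set v := c :: u; pose J := seq_fset tt (iota 0 (size v)).
have JE i : (i \in J) = (i < size v)%N by rewrite seq_fsetE mem_iota.
rewrite [cylinder X v](_ : _ =
    [set w | forall i, i \in J -> X w i \in [set nth c v i]%SET]).
  rewrite iX (perm_big (iota 0 (size v))); last first.
    apply: uniq_perm => [||i]; [exact: fset_uniq|exact: iota_uniq|].
    by rewrite JE mem_iota.
  transitivity (\prod_(i <- iota 0 (size v)) (p (nth c v i))%:E)%E.
    apply: eq_bigr => i _; rewrite -(pX i); congr (P _).
    by apply/seteqP; split=> w /= /set1P.
  rewrite prodEFin; congr EFin; rewrite /word_mass (big_nth c).
  by rewrite /index_iota subn0.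
apply/seteqP; split=> w; rewrite /cylinder /=.
- move=> wv i; rewrite JE => iv; apply/set1P.
  by rewrite -wv nth_mkseq.
- move=> wv; apply: (@eq_from_nth _ c); rewrite size_mkseq // => i iv.
  by rewrite nth_mkseq //; apply/set1P/wv; rewrite JE.
Qed.
End Iid.
End Measure.

(** * Entropy and exponential bounds on word masses *)

Lemma distribution_le1 {R : realType} {T : finType} (p : T -> R) a :
  is_distribution p -> p a <= 1.
Proof.
move=> [p0 <-]; rewrite (bigD1 a) //= lerDl; exact: sumr_ge0.
Qed.

(** A letter of mass 1 forces all other masses to be 0, and then every summand of the entropy
    vanishes. *)
Lemma entropy_gt0_lt1 {R : realType} {T : finType} (p : T -> R) a :
  is_distribution p -> 0 < entropy p -> p a < 1.
Proof.
move=> pd Hp; rewrite lt_neqAle distribution_le1 // andbT.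
apply: contraTneq Hp => pa1; case: (pd) => p0.
rewrite (bigD1 a) //= pa1 => /eqP; rewrite -subr_eq0 addrAC subrr add0r.
rewrite psumr_eq0 => [/allP pb|b _]; last exact: p0.
rewrite /entropy big1 ?oppr0 ?ltxx // => b _.
have [->|ba] := eqVneq b a; first by rewrite pa1 ln1 mul0r mulr0.
by have := pb b (mem_index_enum _); rewrite ba => /eqP ->; rewrite mul0r.
Qed.

Section WordMass.
Context {R : realType} {Sigma Gamma : finType}.
Context (mu : Sigma -> R) (nu : Gamma -> R).
Hypotheses (mu_dist : is_distribution mu) (nu_dist : is_distribution nu).
Hypothesis mu_gt0 : forall a, 0 < mu a.
Hypothesis Hnu_gt0 : 0 < entropy nu.

Lemma word_mass_lbound :
  exists2 a, 0 < a & forall u, a ^+ size u <= word_mass mu u.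
Proof.
(* All masses being at most 1, their product is a positive lower bound of each. *)
exists (\prod_c mu c); first exact: prodr_gt0.
elim=> [|c u IH]; first by rewrite /word_mass big_nil.
rewrite /word_mass big_cons exprS ler_pM //.
- by apply/ltW/prodr_gt0.
- by apply/ltW/exprn_gt0/prodr_gt0.
- rewrite (bigD1 c) //= ler_piMr ?(ltW (mu_gt0 _)) // prodr_ile1 // => b _.
  by rewrite ltW //= distribution_le1.
Qed.

Lemma word_mass_ubound :
  exists2 b, 0 < b < 1 & forall u, word_mass nu u <= b ^+ size u.
Proof.
(* The base value 1/2 keeps [b] positive. *)
pose b := \big[Num.max/2^-1]_c nu c.
have b0 : 0 < b by apply: lt_le_trans (bigmax_ge_id _ _ _ _); rewrite invr_gt0.
exists b.
  rewrite b0 bigmax_lt // ?invf_lt1 ?ltr1n // => c _.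
  exact: entropy_gt0_lt1.
elim=> [|c u IH]; first by rewrite /word_mass big_nil.
rewrite /word_mass big_cons exprS ler_pM //; last exact: le_bigmax.
- by case: nu_dist.
- by apply: prodr_ge0 => ? _; case: nu_dist.
Qed.

(* [mu(x) <= nu(y)] bounds [y] linearly: [mu(x)] is at least exponentially small
   in [size x], [nu(y)] at most exponentially small in [size y]. *)
Lemma size_le_word_mass : exists K, forall x y,
  word_mass mu x <= word_mass nu y -> (size y <= K * size x)%N.
Proof.
have [a a0 mua] := word_mass_lbound.
have [b /andP[b0 b1] nub] := word_mass_ubound.
(* Any [K] with b^K < a works: b^(K|x|) <= a^|x| <= mu(x) <= nu(y) <= b^|y|, and b < 1. *)
have : (fun n => b ^+ n) @ \oo --> (0 : R) by apply: cvg_expr; rewrite gtr0_norm.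
move=> /cvgrPdist_lt /(_ a a0)[K _ /(_ K (leqnn K))] /=.
rewrite sub0r normrN gtr0_norm ?exprn_gt0 // => bK.
exists K => x y xy; rewrite -(ler_iXn2l b0 b1).
apply: le_trans (nub y); apply: le_trans xy; apply: le_trans (mua x).
rewrite exprM lerXn2r ?nnegrE //; first exact/ltW/exprn_gt0.
- exact: ltW.
- exact: ltW.
Qed.
End WordMass.

(** * Code words and factors of the random stream *)

Section Stream.
Context {d : measure_display} {Omega : measurableType d} {R : realType}.
Context (P : probability Omega R) {Sigma Gamma : finType}.
Context (mu : Sigma -> R) (nu : Gamma -> R) (alpha : Omega -> nat -> Sigma).
Hypothesis mu_gt0 : forall a, 0 < mu a.
Hypothesis alpha_iid : iid P alpha mu.

Section OneCode.
Variable A : {fset seq Sigma}.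
Hypothesis A_prefix : prefix_code A.
Hypothesis A_exhaustive : exhaustive P alpha A.

Lemma exhaustive_event : [set w | exists n, mkseq (alpha w) n \in A] =
  [set w | exists2 y, y \in (A : seq _) & cylinder alpha y w].
Proof.
apply/seteqP; split=> w /= => [[n wA]|[y yA wy]].
- by exists (mkseq (alpha w) n) => //; rewrite /cylinder /= size_mkseq.
- by exists (size y); rewrite wy.
Qed.

(** Distinct code words have disjoint cylinders, and exhaustiveness says that their union has
    probability 1. *)
Lemma exhaustive_mass : \sum_(y <- A) word_mass mu y = 1.
Proof.
apply: EFin_inj; rewrite -A_exhaustive exhaustive_event.
rewrite probability_finite_union ?fset_uniq //.
- rewrite -sumEFin; apply: eq_bigr => y _.
  by rewrite (probability_cylinder alpha_iid).
- exact: measurable_cylinder alpha_iid.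
- move=> x y w xA yA wx wy.
  apply: (prefix_code_eq (w := mkseq (alpha w) (maxn (size x) (size y)))
    A_prefix xA yA).
  + by rewrite -{1}wx prefix_mkseq // leq_maxl.
  + by rewrite -{1}wy prefix_mkseq // leq_maxr.
Qed.

(* Finiteness of [A] matters here: a stream without prefix in [A] would have a
   whole cylinder of positive mass of such streams around it. *)
Lemma exhaustive_total a : exists n, mkseq a n \in A.
Proof.
apply: contrapT => aA.
(* This prefix is as long as the longest code word, so a stream starting with [u] has a prefix in
   [A] only if [a] has one. *)
pose u := mkseq a (\max_(y <- A) size y).
have mE : measurable [set w | exists n, mkseq (alpha w) n \in A].
  rewrite exhaustive_event finite_union_set; apply: bigsetU_measurable => y _.
  exact: measurable_cylinder alpha_iid y.
have mu_ : measurable (cylinder alpha u) := measurable_cylinder alpha_iid u.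
have := probability_le1 P (measurableU _ _ mE mu_).
rewrite measureU //; last first.
  rewrite -subset0 => w /= [[n wA] wu]; apply: aA; exists n.
  have nu_ : (n <= \max_(y <- A) size y)%N.
    by rewrite -(size_mkseq (alpha w) n); apply: leq_bigmax_seq.
  suff -> : mkseq a n = mkseq (alpha w) n by [].
  have := prefix_mkseq a nu_; rewrite -/u -wu => /mkseq_prefix.
  by rewrite size_mkseq.
rewrite [X in (X + _)%E]A_exhaustive.
rewrite [X in (_ + X)%E](probability_cylinder alpha_iid).
rewrite -EFinD lee_fin gerDl leNgt => /negP; apply.
by apply: prodr_gt0.
Qed.

Variable f : seq Sigma -> seq Gamma.
Hypothesis Af_reduction : restart_reduction P alpha nu A f.

(** With the empty word in [A] nothing is ever output, so the first output letter is always [None],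
    which has mass 0 under the reduction. *)
Lemma reduction_nonnil : [::] \notin A.
Proof.
apply/negP => nA; have [_ /(_ 0%N None) /eqP + _] := Af_reduction.
rewrite [X in P X](_ : _ = setT).
  by rewrite probability_setT eqe oner_eq0.
apply/seteqP; split=> w //= _; rewrite /output_letter.
case: xgetP => // y _ [y0 [n]].
rewrite (restart_output_nil f A_prefix _ nA) onth0n => y0'.
by rewrite -y0' eqxx in y0.
Qed.

(** Every input starting with [x] yields an output starting with [f x]; the two sides are the
    probabilities of these cylinders. *)
Lemma reduction_mass x : x \in A -> word_mass mu x <= word_mass nu (f x).
Proof.
move=> xA; have nA := reduction_nonnil.
rewrite -lee_fin -(probability_cylinder alpha_iid).
set p := fun o => if o is Some b then nu b else 0 : R.
have -> : word_mass nu (f x) = word_mass p (map some (f x)).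
  by rewrite /word_mass big_map.
rewrite -(probability_cylinder Af_reduction).
apply: le_measure; rewrite ?inE.
- exact: measurable_cylinder alpha_iid _.
- exact: measurable_cylinder Af_reduction _.
move=> w wx; rewrite /cylinder /= size_map.
apply: (@eq_from_nth _ None); rewrite size_mkseq ?size_map // => i ifx.
rewrite nth_mkseq //.
case E : (f x) ifx => [//|b s]; rewrite -E => ifx.
rewrite (nth_map b) //.
apply: (output_letterE (n := size x)); rewrite wx restart_output //.
  by rewrite onthE (nth_map b).
by apply: contraNneq nA => <-.
Qed.
End OneCode.

Section Codes.
Variable A : nat -> {fset seq Sigma}.
Hypothesis A_prefix : forall k, prefix_code (A k).
Hypothesis A_exhaustive : forall k, exhaustive P alpha (A k).
Hypothesis A_nonnil : forall k, [::] \notin A k.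

Lemma stream_factorization a : factorization A a (Defs.factor A a).
Proof. by apply: factor_factorization => // k b; apply: exhaustive_total. Qed.

Lemma factor_words a k : mkseq (Defs.factor A a) k \in words A k.
Proof.
have [xA _ _] := stream_factorization a.
by apply/mem_words; rewrite size_mkseq; split=> // i ik; rewrite nth_mkseq.
Qed.

(** This turns events on the first [k] factors into cylinders of input letters; one direction is
    uniqueness of the factorization. *)
Lemma factor_cylinder a k ys : ys \in words A k ->
  mkseq (Defs.factor A a) k = ys <-> mkseq a (size (flatten ys)) = flatten ys.
Proof.
move=> /mem_words[sz ysA]; have xP := stream_factorization a; split=> [<-|ya].
  by case: xP => _ <-.
rewrite -sz; apply: (factorization_unique A_prefix xP _ ya) => i.
by rewrite sz; apply: ysA.
Qed.

Lemma factor_event k (Q : pred (seq (seq Sigma))) :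
  [set w | Q (mkseq (Defs.factor A (alpha w)) k)] =
  [set w | exists2 ys, ys \in [seq ys <- words A k | Q ys] &
     cylinder alpha (flatten ys) w].
Proof.
apply/seteqP; split=> w /= => [Qw|[ys]].
- exists (mkseq (Defs.factor A (alpha w)) k).
    by rewrite mem_filter Qw factor_words.
  exact: (factor_cylinder (alpha w) (factor_words (alpha w) k)).1.
- by rewrite mem_filter => /andP[Qys ysk] /(factor_cylinder _ ysk) ->.
Qed.

Lemma measurable_factor_event k (Q : pred (seq (seq Sigma))) :
  measurable [set w | Q (mkseq (Defs.factor A (alpha w)) k)].
Proof.
rewrite factor_event finite_union_set; apply: bigsetU_measurable => ys _.
exact: measurable_cylinder alpha_iid _.
Qed.

Lemma probability_factor_event k (Q : pred (seq (seq Sigma))) :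
  P [set w | Q (mkseq (Defs.factor A (alpha w)) k)] =
  (words_sum mu A k (fun ys => (Q ys)%:R))%:E.
Proof.
rewrite factor_event probability_finite_union ?filter_uniq ?words_uniq //.
- rewrite big_filter /words_sum -sumEFin big_mkcond; apply: eq_bigr => ys _.
  by case: ifP; rewrite ?mulr1 ?mulr0 // (probability_cylinder alpha_iid).
- by move=> ys; exact: measurable_cylinder alpha_iid _.
- move=> ys zs w; rewrite !mem_filter => /andP[_ ysk] /andP[_ zsk].
  by move=> /(factor_cylinder _ ysk) <- /(factor_cylinder _ zsk) <-.
Qed.

(** The factor x_k takes finitely many values, so the integral is a finite sum, and Pr(x_k = y) =
    mu(y). *)
Lemma expectation_factor k (g : seq Sigma -> R) : (forall y, 0 <= g y) ->
  ('E_P[fun w => g (Defs.factor A (alpha w) k)])%E = (mean mu A k g)%:E.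
Proof.
move=> g0; pose E y := [set w | Defs.factor A (alpha w) k = y].
(* An event on x_k alone is read off the tuple of the first [k.+1] factors, whose last entry is
   x_k. *)
pose Q y : pred (seq (seq Sigma)) := fun ys => last [::] ys == y.
have EE y : E y = [set w | Q y (mkseq (Defs.factor A (alpha w)) k.+1)].
  have lastE (x : nat -> seq Sigma) : last [::] (mkseq x k.+1) = x k.
    by rewrite mkseqS last_rcons.
  by apply/seteqP; split=> w; rewrite /E /Q /mkset lastE => /eqP.
have mE y : measurable (E y) by rewrite EE; exact: measurable_factor_event.
have PE y : y \in A k -> P (E y) = (word_mass mu y)%:E.
  move=> yA; rewrite EE probability_factor_event; congr EFin.
  (* Summing out the first [k] words leaves a factor 1, since each code has total mass 1. *)
  rewrite words_sumS -[RHS](words_sum_cst (A := A) (mu := mu) _ k); last first.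
    by move=> ?; apply: exhaustive_mass.
  congr words_sum; apply: funext => ys; rewrite /mean /Q.
  rewrite (bigD1_seq y) ?fset_uniq //= last_rcons eqxx mulr1.
  rewrite big1 ?addr0 // => z zy.
  by rewrite last_rcons (negbTE zy) mulr0.
rewrite unlock.
transitivity (\int[P]_w \sum_(y <- A k) ((g y)%:E * (\1_(E y) w)%:E))%E.
  apply: eq_integral => w _; set y := Defs.factor A (alpha w) k.
  have yA : y \in A k by case: (stream_factorization (alpha w)) => + _ _; apply.
  rewrite (bigD1_seq y) ?fset_uniq //= indicE mem_set // mule1.
  rewrite big1 ?adde0 // => z zy.
  rewrite indicE memNset ?mule0 // /E /= => yz.
  by rewrite -yz eqxx in zy.
rewrite ge0_integral_sum //; last 2 first.
- move=> y; apply: measurable_funeM; apply/measurable_EFinP.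
  exact: measurable_indic.
- by move=> y w _; rewrite mule_ge0 // lee_fin.
rewrite /mean -sumEFin big_seq [RHS]big_seq; apply: eq_bigr => y yA.
rewrite ge0_integralZl_EFin //; last first.
  by apply/measurable_EFinP; exact: measurable_indic.
by rewrite integral_indic // setIT [X in (_ * X)%E](PE _ yA) -EFinM mulrC.
Qed.
End Codes.
End Stream.

(** The iterations lying between times [n] and [T] produce at most [K] letters per letter read. The
    subtractions are truncated. The extra word [x j] is the one running at time [n], when its output
    is still pending. *)
Lemma serial_output_lipschitz {Sigma : finType} {Gamma : Type}
    (A : nat -> {fset seq Sigma}) (f : nat -> seq Sigma -> seq Gamma)
    (K : nat) (a : nat -> Sigma) (x : nat -> seq Sigma) (n k : nat) :
  (forall k, prefix_code (A k)) -> (forall k, [::] \notin A k) ->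
  factorization A a x ->
  (forall i, (size (f i (x i)) <= K * size (x i))%N) ->
  let D := size (output (serial_step A f) (serial_start Sigma) (mkseq a n)) in
  let T := (\sum_(0 <= i < k) size (x i))%N in
  let S := (\sum_(0 <= i < k) size (f i (x i)))%N in
  (D <= S + K * (n - T))%N /\
  exists2 j, (j <= k)%N & (S <= D + K * (T - n + size (x j)))%N.
Proof.
move=> A_prefix A_nonnil xP fK D T S; rewrite /D {D}.
have [j [Tj Tj1 ->]] := serial_output_size f A_prefix A_nonnil n xP.
have sum_le m m' : (\sum_(m <= i < m') size (f i (x i)) <=
    K * \sum_(m <= i < m') size (x i))%N.
  by rewrite big_distrr /=; apply: leq_sum.
case: (leqP k j) => kj.
- have ET := big_cat_nat (leq0n k) kj (F := fun i => size (x i))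
    (P := xpredT) (op := addn).
  have ES := big_cat_nat (leq0n k) kj (F := fun i => size (f i (x i)))
    (P := xpredT) (op := addn).
  rewrite -/T in ET; rewrite -/S in ES; have := sum_le k j.
  (* Here [S <= D], so any index serves as witness for the second bound. *)
  rewrite ES; move: ET => /= ET le1; split; last by exists k => //; lia.
  by rewrite leq_add2l; apply: leq_trans le1 _; rewrite leq_mul2l; lia.
- have ET := big_cat_nat (leq0n j) (ltnW kj) (F := fun i => size (x i))
    (P := xpredT) (op := addn).
  have ES := big_cat_nat (leq0n j) (ltnW kj) (F := fun i => size (f i (x i)))
    (P := xpredT) (op := addn).
  rewrite -/T in ET; rewrite -/S in ES; have := sum_le j k.
  rewrite big_nat_recr //= in Tj1.
  rewrite ES; move: ET => /= ET le1; split; first by rewrite -addnA leq_addr.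
  exists j; first exact: ltnW.
  rewrite leq_add2l; apply: leq_trans le1 _; rewrite leq_mul2l.
  by apply/orP; right; lia.
Qed.

(** * Asymptotic hypotheses as bounds uniform in the index *)

Section PartialSums.
Context {R : realType} (c p m : nat -> R) (l h : R).
Let tau k := \sum_(0 <= i < k) c i.
Let pi_ k := \sum_(0 <= i < k) p i.
Hypotheses (h_gt0 : 0 < h) (c_ge : forall i, h <= c i).
Hypothesis m_ge0 : forall i, 0 <= m i.

Lemma partial_sum_ge k : k%:R * h <= tau k.
Proof.
elim: k => [|k IH]; first by rewrite mul0r /tau big_nil.
by rewrite /tau big_nat_recr //= -natr1 mulrDl mul1r lerD.
Qed.

Lemma partial_sum_homo j k : (j <= k)%N -> tau j <= tau k.
Proof.
move=> jk; rewrite /tau (big_cat_nat (leq0n j) jk) /= lerDl.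
by apply: sumr_ge0 => i _; apply: le_trans (ltW h_gt0) (c_ge i).
Qed.

Lemma partial_sum_ge0 k : 0 <= tau k.
Proof. by apply: le_trans (partial_sum_ge k); rewrite mulr_ge0 // ltW. Qed.

Lemma partial_sum_bracket N : 0 <= N -> exists k, tau k <= N < tau k.+1.
Proof.
move=> N0; have exk : exists k, N < tau k.+1.
  exists (Num.truncn (N / h)); apply: lt_le_trans (partial_sum_ge _).
  by rewrite -ltr_pdivrMr // truncnS_gt.
case: (ex_minnP exk) => k Nk k_min; exists k; rewrite Nk andbT.
case: k Nk k_min => [|k] _ k_min; first by rewrite /tau big_nil.
by rewrite leNgt; apply/negP => /k_min; rewrite ltnn.
Qed.

(** The finitely many early terms go into [B]; for later ones [tau i <= tau k] by monotonicity. *)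
Lemma littleo_uniform eps : 0 < eps ->
  (m : nat -> R^o) =o_\oo (tau : nat -> R^o) ->
  exists2 B, 0 <= B & forall k i, (i <= k)%N -> m i <= B + eps * tau k.
Proof.
move=> eps0 /eqoP /(_ eps eps0) [n0 _ mo].
exists (\sum_(0 <= i < n0) m i); first exact: sumr_ge0.
move=> k i ik; have [in0|n0i] := ltnP i n0.
- rewrite (bigD1_seq i) ?mem_index_iota ?iota_uniq //= -addrA lerDl addr_ge0 //.
    exact: sumr_ge0.
  by rewrite mulr_ge0 ?(ltW eps0) ?partial_sum_ge0.
- apply: le_trans (ler_norm _) _; apply: le_trans (mo i n0i) _.
  rewrite ger0_norm ?partial_sum_ge0 //; apply: le_trans (_ : _ <= eps * tau k) _.
    by rewrite ler_pM2l // partial_sum_homo.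
  by rewrite lerDr; apply: sumr_ge0.
Qed.

(** The convergence is multiplied out by [tau k]; early indices, including [k = 0] where the ratio
    is meaningless, go into [B]. *)
Lemma ratio_uniform eps : 0 < eps ->
  pi_ n.+1 / tau n.+1 @[n --> \oo] --> l ->
  exists2 B, 0 <= B & forall k, `|pi_ k - l * tau k| <= B + eps * tau k.
Proof.
move=> eps0 /cvgrPdist_lt /(_ eps eps0) [n0 _ lim].
exists (\sum_(0 <= i < n0.+1) `|pi_ i - l * tau i|); first exact: sumr_ge0.
move=> k; have [kn0|] := ltnP k n0.+1.
- rewrite (bigD1_seq k) ?mem_index_iota ?iota_uniq //= -addrA lerDl addr_ge0 //.
    exact: sumr_ge0.
  by rewrite mulr_ge0 ?(ltW eps0) ?partial_sum_ge0.
- case: k => // k n0k.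
  have tau0 : 0 < tau k.+1.
    by apply: lt_le_trans (partial_sum_ge _); rewrite mulr_gt0.
  have /ltW := lim k n0k; rewrite distrC => lek.
  have -> : pi_ k.+1 - l * tau k.+1 = (pi_ k.+1 / tau k.+1 - l) * tau k.+1.
    by rewrite mulrBl divfK // gt_eqF.
  rewrite normrM (gtr0_norm tau0); apply: le_trans (_ : _ <= eps * tau k.+1) _.
    by rewrite ler_pM2r.
  by rewrite lerDr; apply: sumr_ge0.
Qed.
End PartialSums.

(** * Concentration and the efficiency estimate *)

Section Efficiency.
Context {d : measure_display} {Omega : measurableType d} {R : realType}.
Context (P : probability Omega R) {Sigma Gamma : finType}.
Context (mu : Sigma -> R) (nu : Gamma -> R) (alpha : Omega -> nat -> Sigma).
Context (A : nat -> {fset seq Sigma}) (f : nat -> seq Sigma -> seq Gamma).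
Hypothesis mu_gt0 : forall a, 0 < mu a.
Hypotheses (Hmu_gt0 : 0 < entropy mu) (Hnu_gt0 : 0 < entropy nu).
Hypothesis alpha_iid : iid P alpha mu.
Hypothesis A_prefix : forall k, prefix_code (A k).
Hypothesis A_exhaustive : forall k, exhaustive P alpha (A k).
Hypothesis A_nonnil : forall k, [::] \notin A k.
Variable K : nat.
Hypothesis size_f : forall k y, y \in A k -> (size (f k y) <= K * size y)%N.

(** Consumption and production as functions of a code word; their finite means [c] and [p] are later
    identified with the expectations. *)
Let gC (i : nat) (y : seq Sigma) : R := entropy mu * (size y)%:R.
Let gP (i : nat) (y : seq Sigma) : R := entropy nu * (size (f i y))%:R.
Let c i := mean mu A i (gC i).
Let p i := mean mu A i (gP i).
Let tau k := \sum_(0 <= i < k) c i.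
Let kappa : R := entropy nu * K%:R / entropy mu.

Let mu_ge0 a : 0 <= mu a. Proof. exact: ltW. Qed.
Let A_mass k : \sum_(y <- A k) word_mass mu y = 1.
Proof. exact: (exhaustive_mass alpha_iid (@A_prefix k) (@A_exhaustive k)). Qed.
Let kappa_ge0 : 0 <= kappa.
Proof. by rewrite divr_ge0 ?mulr_ge0 ?ler0n // ltW. Qed.
Let gC_ge0 i y : 0 <= gC i y.
Proof. by rewrite mulr_ge0 // ltW. Qed.
Let gP_ge0 i y : 0 <= gP i y.
Proof. by rewrite mulr_ge0 // ltW. Qed.

Let gP_le i y : y \in A i -> gP i y <= kappa * gC i y.
Proof.
move=> /size_f fy; rewrite /kappa /gC mulrA divfK ?gt_eqF // -mulrA.
by rewrite ler_pM2l // -natrM ler_nat.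
Qed.

Let gC_le i y : y \in A i -> gC i y <= max_consumption mu A i.
Proof.
by move=> yA; rewrite ler_pM2l // ler_nat; apply: (leq_bigmax_seq (F := size)).
Qed.

Lemma mean_consumption_ge i : entropy mu <= c i.
Proof.
rewrite -[leLHS](mean_cst A_mass i); apply: mean_le => // y yA.
rewrite ler_peMr ?(ltW Hmu_gt0) // ler1n lt0n size_eq0.
by apply: contraTneq yA => ->.
Qed.

Lemma mean_consumption_le i : c i <= max_consumption mu A i.
Proof. by rewrite -[leRHS](mean_cst A_mass i); apply: mean_le => // y /gC_le. Qed.

Lemma deviation_factor (g : nat -> seq Sigma -> R) k a :
  deviation mu A g k (mkseq (Defs.factor A a) k) =
  \sum_(0 <= i < k) g i (Defs.factor A a i) -
  \sum_(0 <= i < k) mean mu A i (g i).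
Proof.
rewrite /deviation -sumrB; apply: eq_big_nat => i /andP[_ ik].
by rewrite nth_mkseq.
Qed.

(** A word costs at most [b], so E C_i^2 <= b c_i; passing from C_i to P_i costs the factor
    kappa^2. *)
Lemma second_moments_le k b :
  (forall i, (i < k)%N -> max_consumption mu A i <= b) ->
  \sum_(0 <= i < k) mean mu A i (fun y => gC i y ^+ 2) +
  \sum_(0 <= i < k) mean mu A i (fun y => gP i y ^+ 2) <=
  (1 + kappa ^+ 2) * (b * tau k).
Proof.
move=> mb.
have le_C : \sum_(0 <= i < k) mean mu A i (fun y => gC i y ^+ 2) <= b * tau k.
  rewrite /tau mulr_sumr big_nat_cond [leRHS]big_nat_cond.
  apply: ler_sum => i /andP[/andP[_ ik] _]; rewrite -meanZ; apply: mean_le => //.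
  by move=> y yA; rewrite expr2 ler_wpM2r // (le_trans (gC_le yA)) // mb.
have le_P : \sum_(0 <= i < k) mean mu A i (fun y => gP i y ^+ 2) <=
    kappa ^+ 2 * \sum_(0 <= i < k) mean mu A i (fun y => gC i y ^+ 2).
  rewrite mulr_sumr; apply: ler_sum => i _; rewrite -meanZ; apply: mean_le => //.
  by move=> y yA; rewrite -exprMn lerXn2r ?nnegrE ?gP_le // mulr_ge0.
rewrite mulrDl mul1r; apply: lerD => //; apply: le_trans le_P _.
by rewrite ler_wpM2l ?sqr_ge0.
Qed.

(** A deterministic estimate for a single stream on which both partial sums are within [t] of their
    means. *)
Lemma efficiency_near n k b b' t l a :
  let N := n%:R * entropy mu in
  (forall i, (i <= k)%N -> max_consumption mu A i <= b) ->
  tau k <= N < tau k.+1 ->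
  `|\sum_(0 <= i < k) p i - l * tau k| <= b' ->
  `|deviation mu A gC k (mkseq (Defs.factor A a) k)| <= t ->
  `|deviation mu A gP k (mkseq (Defs.factor A a) k)| <= t ->
  `|entropy nu * (size (output (serial_step A f) (serial_start Sigma)
       (mkseq a n)))%:R - l * N| <=
  kappa * (2 * b + t) + t + b' + `|l| * b.
Proof.
move=> N mb /andP[tauN Ntau] pb'; rewrite !deviation_factor => Ct Pt.
have xP : factorization A a (Defs.factor A a).
  exact: (stream_factorization mu_gt0 alpha_iid A_exhaustive A_nonnil).
have [xA _ _] := xP.
set x := Defs.factor A a in xP xA Ct Pt *.
have [|D_le [j jk D_ge]] := @serial_output_lipschitz _ _ A f K a x n k
    A_prefix A_nonnil xP _; first by move=> i; apply: size_f.
set D := size _ in D_le D_ge *.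
set T := (\sum_(0 <= i < k) size (x i))%N in D_le D_ge.
set S := (\sum_(0 <= i < k) size (f i (x i)))%N in D_le D_ge.
have ET : \sum_(0 <= i < k) gC i (x i) = entropy mu * T%:R.
  by rewrite /T natr_sum mulr_sumr.
have ES : \sum_(0 <= i < k) gP i (x i) = entropy nu * S%:R.
  by rewrite /S natr_sum mulr_sumr.
rewrite ET -/(tau k) in Ct; rewrite ES in Pt.
have ck : N - tau k <= b.
  rewrite lerBlDl; apply: le_trans (ltW Ntau) _.
  rewrite /tau big_nat_recr //= lerD2l.
  exact: le_trans (mean_consumption_le k) (mb k (leqnn k)).
have xj : entropy mu * (size (x j))%:R <= b.
  exact: le_trans (gC_le (xA j)) (mb j jk).
pose dT := `|N - entropy mu * T%:R|.
(* In units of consumption, time [n] is at most [b] beyond the mean end of [k] iterations, and their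
   actual end is within [t] of that mean. *)
have dT_le : dT <= b + t.
  rewrite /dT.
  have -> : N - entropy mu * T%:R =
      (N - tau k) - (entropy mu * T%:R - tau k) by ring.
  apply: le_trans (ler_normB _ _) _; apply: lerD => //.
  by rewrite ger0_norm // subr_ge0.
have b0 : 0 <= b by apply: le_trans xj; exact: gC_ge0.
have kappaE y : kappa * (entropy mu * y) = entropy nu * (K%:R * y).
  by rewrite /kappa mulrA divfK ?gt_eqF // mulrA.
have subE u v : entropy mu * (u - v)%N%:R <=
    `|u%:R * entropy mu - entropy mu * v%:R|.
  have [uv|vu] := leqP u v.
    by rewrite (eqP uv) mulr0.
  rewrite natrB ?(ltnW vu) // mulrBr [u%:R * _]mulrC; exact: ler_norm.
have D_up : entropy nu * D%:R - entropy nu * S%:R <= kappa * (b + t).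
  rewrite -mulrBr.
  apply: le_trans (_ : _ <= kappa * (entropy mu * (n - T)%N%:R)) _.
    rewrite kappaE ler_pM2l // lerBlDl -natrM -natrD ler_nat //.
  rewrite ler_wpM2l //; exact: le_trans (subE n T) dT_le.
(* The second [b] pays for the word still unfinished at time [n]. *)
have D_lo : entropy nu * S%:R - entropy nu * D%:R <= kappa * (b + t + b).
  rewrite -mulrBr.
  apply: le_trans (_ : _ <= kappa * (entropy mu * (T - n + size (x j))%N%:R)) _.
    rewrite kappaE ler_pM2l // lerBlDl -natrM -natrD ler_nat //.
  rewrite ler_wpM2l // natrD mulrDr lerD //.
  apply: le_trans (subE T n) _; apply: le_trans dT_le; rewrite /dT /N distrC.
  by rewrite [_ * T%:R]mulrC [_ * n%:R]mulrC.
have D_dist : `|entropy nu * D%:R - entropy nu * S%:R| <= kappa * (2 * b + t).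
  have -> : 2 * b + t = b + t + b by ring.
  rewrite ler_norml lerNl opprB D_lo /=; apply: le_trans D_up _.
  by rewrite ler_wpM2l // lerDl.
have -> : entropy nu * D%:R - l * N =
    (entropy nu * D%:R - entropy nu * S%:R) +
    (entropy nu * S%:R - \sum_(0 <= i < k) p i) +
    (\sum_(0 <= i < k) p i - l * tau k) + l * (tau k - N) by ring.
apply: le_trans (ler_normD _ _) _; apply: lerD; last first.
  by rewrite normrM ler_wpM2l // distrC ger0_norm // subr_ge0.
apply: le_trans (ler_normD _ _) _; apply: lerD => //.
by apply: le_trans (ler_normD _ _) _; apply: lerD.
Qed.

(** Outside the event [Q] that one of the two deviations exceeds [t], [efficiency_near] gives an
    error of at most [eps]; Chebyshev's inequality bounds the probability of [Q] by [eta]. *)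
Lemma efficiency_tail (l eps eta : R) :
  (max_consumption mu A : nat -> R^o) =o_\oo (tau : nat -> R^o) ->
  (\sum_(0 <= i < n.+1) p i) / tau n.+1 @[n --> \oo] --> l ->
  0 < eps -> 0 < eta ->
  \forall n \near \oo,
    (P [set w | (eps < `|empirical_efficiency mu nu (serial_step A f)
                          (serial_start Sigma) n (alpha w) - l|)%R] <= eta%:E)%E.
Proof.
move=> m_o lim eps0 eta0.
have m_ge0 i : 0 <= max_consumption mu A i by rewrite mulr_ge0 // ltW.
(* With [b <= 2 * t] the error in [efficiency_near] is at most (5 kappa + 3 + 2|l|) t, which is
   below 2 C t = eps N for t = e1 N. *)
pose C := 3 * kappa + 2 + `|l|; have C0 : 0 < C.
  by rewrite /C; have := kappa_ge0; have := normr_ge0 l; lra.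
pose V := 1 + kappa ^+ 2; have V0 : 0 < V by rewrite ltr_pwDl ?sqr_ge0.
pose e1 := eps / (2 * C); have e1_0 : 0 < e1 by rewrite divr_gt0 // mulr_gt0.
(* Chosen so that b <= 2 e2 N makes the Chebyshev bound V b tau_k / t^2 at most [eta]. *)
pose e2 := eta * e1 ^+ 2 / (2 * V).
have e2_0 : 0 < e2 by rewrite divr_gt0 // mulr_gt0 // exprn_gt0.
pose e := Num.min e1 e2; have e0 : 0 < e by rewrite lt_min e1_0.
have [B1 B1_0 mB] := littleo_uniform Hmu_gt0 mean_consumption_ge m_ge0 e0 m_o.
have [B2 B2_0 pB] := ratio_uniform Hmu_gt0 mean_consumption_ge e0 lim.
pose B := B1 + B2; have B0 : 0 <= B by rewrite addr_ge0.
(* From here on the constant [B] is at most both [e1 * N] and [e2 * N]. *)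
exists (Num.truncn (((B / e1) + (B / e2)) / entropy mu)).+1 => //= n n_large.
pose N := n%:R * entropy mu.
have N_large : B / e1 + B / e2 <= N.
  rewrite -ler_pdivrMr //; apply: ltW; apply: lt_le_trans (truncnS_gt _) _.
  by rewrite ler_nat.
have Be1 : B <= e1 * N.
  rewrite mulrC -ler_pdivrMr //; apply: le_trans N_large.
  by rewrite lerDl divr_ge0 // ltW.
have Be2 : B <= e2 * N.
  rewrite mulrC -ler_pdivrMr //; apply: le_trans N_large.
  by rewrite lerDr divr_ge0 // ltW.
have n0 : 0 < n%:R :> R by rewrite ltr0n (leq_trans _ n_large).
have N0 : 0 < N by rewrite mulr_gt0.
have [k tauN] := partial_sum_bracket Hmu_gt0 mean_consumption_ge (ltW N0).
have tau_le : tau k <= N by case/andP: tauN.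
have tau0 : 0 <= tau k := partial_sum_ge0 Hmu_gt0 mean_consumption_ge k.
(* The same [b] bounds the word costs up to index [k] and the error of the ratio. *)
pose b := B + e * N; pose t := e1 * N.
have t0 : 0 < t by rewrite mulr_gt0.
have etau : e * tau k <= e * N by rewrite ler_pM2l.
have mb i : (i <= k)%N -> max_consumption mu A i <= b.
  by move=> /mB; rewrite -/(tau k) /b /B; lra.
have pb : `|\sum_(0 <= i < k) p i - l * tau k| <= b.
  by have := pB k; rewrite -/(tau k) /b /B; lra.
pose Q (ys : seq (seq Sigma)) := (t < `|deviation mu A gC k ys|) ||
                                 (t < `|deviation mu A gP k ys|).
have le_b : b <= 2 * t.
  have : e * N <= e1 * N by rewrite ler_pM2r // ge_min lexx.
  by rewrite /b /t; lra.
have mQ := measurable_factor_event mu_gt0 alpha_iid A_prefix A_exhaustive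
  A_nonnil k Q.
apply: le_trans (_ : _ <= P [set w | Q (mkseq (Defs.factor A (alpha w)) k)])%E _.
  apply: le_measure; rewrite ?inE //.
    exact: (measurable_prefix_event alpha_iid n (fun u => eps <
      `|(size (output (serial_step A f) (serial_start Sigma) u))%:R / n%:R *
        (entropy nu / entropy mu) - l|)).
  move=> w /=; apply: contraTT; rewrite negb_or -!leNgt => /andP[Ct Pt].
  have := efficiency_near mb tauN pb Ct Pt.
  set D := size _; rewrite -/N => D_near.
  have -> : empirical_efficiency mu nu (serial_step A f) (serial_start Sigma) n
      (alpha w) - l = (entropy nu * D%:R - l * N) / N.
    rewrite /empirical_efficiency -/D /N; field.
    by rewrite !gt_eqF.
  rewrite normrM normfV (gtr0_norm N0) ler_pdivrMr //.
  apply: le_trans D_near _.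
  have -> : eps * N = 2 * C * t by rewrite /t /e1; field; rewrite gt_eqF.
  have kb : kappa * (2 * b + t) <= kappa * (5 * t) by rewrite ler_wpM2l //; lra.
  have lb : `|l| * b <= `|l| * (2 * t) by rewrite ler_wpM2l.
  have kt : 0 <= kappa * t by rewrite mulr_ge0 // ltW.
  by rewrite /C; lra.
rewrite [leLHS](probability_factor_event mu_gt0 alpha_iid A_prefix A_exhaustive
  A_nonnil) lee_fin.
apply: le_trans (_ : _ <=
    words_sum mu A k (fun ys => (t < `|deviation mu A gC k ys|)%R%:R) +
    words_sum mu A k (fun ys => (t < `|deviation mu A gP k ys|)%R%:R)) _.
  rewrite -words_sumD; apply: words_sum_le => // ys _; rewrite /Q.
  by case: (t < _); case: (t < _) => /=; rewrite ?addr0 ?add0r // lerDl.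
apply: le_trans (lerD (words_chebyshev mu_ge0 A_mass _ _ t0)
  (words_chebyshev mu_ge0 A_mass _ _ t0)) _.
rewrite -mulrDl ler_pdivrMr ?exprn_gt0 //.
apply: le_trans (second_moments_le (b := b) _) _.
  by move=> i /ltnW; apply: mb.
have b_le : b <= 2 * (e2 * N).
  have : e * N <= e2 * N by rewrite ler_pM2r // ge_min lexx orbT.
  by rewrite /b; lra.
have -> : eta * t ^+ 2 = V * (2 * (e2 * N) * N).
  by rewrite /t /e2; field; rewrite gt_eqF.
rewrite ler_pM2l // ler_pM //.
by rewrite addr_ge0 // mulr_ge0 // ltW.
Qed.
End Efficiency.

(** * From expectations to finite means, and the limit *)

Theorem theorem3 (R : realType) (Sigma Gamma : finType)
    (mu : Sigma -> R) (nu : Gamma -> R)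
    (mu_dist : is_distribution mu) (nu_dist : is_distribution nu)
    (mu_gt0 : forall a, 0 < mu a)
    (Hmu_gt0 : 0 < entropy mu) (Hnu_gt0 : 0 < entropy nu)
    (d : measure_display) (Omega : measurableType d) (P : probability Omega R)
    (alpha : Omega -> nat -> Sigma) (alpha_iid : iid P alpha mu)
    (A : nat -> {fset seq Sigma}) (f : nat -> seq Sigma -> seq Gamma)
    (A_prefix : forall k, prefix_code (A k))
    (A_exhaustive : forall k, exhaustive P alpha (A k))
    (Af_reduction : forall k, restart_reduction P alpha nu (A k) (f k))
    (m_littleo : (max_consumption mu A : nat -> R^o) =o_\oo
       (fun n => \sum_(0 <= i < n) mean_consumption P alpha mu A i : R^o))
    (l : R)
    (l_lim : (\sum_(0 <= i < n.+1) mean_production P alpha nu A f i) /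
             (\sum_(0 <= i < n.+1) mean_consumption P alpha mu A i)
             @[n --> \oo] --> l) :
  has_efficiency P alpha mu nu (serial_step A f) (serial_start Sigma) l.
Proof.
have A_nonnil k : [::] \notin A k.
  exact: (reduction_nonnil (@A_prefix k) (@Af_reduction k)).
have [K size_K] := size_le_word_mass mu_dist nu_dist mu_gt0 Hnu_gt0.
have size_f k y : y \in A k -> (size (f k y) <= K * size y)%N.
  move=> yA; apply: size_K.
  exact: (reduction_mass alpha_iid (@A_prefix k) (@Af_reduction k)).
have meanC : mean_consumption P alpha mu A =
    fun i => mean mu A i (fun y => entropy mu * (size y)%:R).
  apply: funext => i; rewrite /mean_consumption /consumption.
  rewrite (expectation_factor mu_gt0 alpha_iid A_prefix A_exhaustive A_nonnil i
    (g := fun y => entropy mu * (size y)%:R)) //.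
  by move=> y; rewrite mulr_ge0 // ltW.
have meanP : mean_production P alpha nu A f =
    fun i => mean mu A i (fun y => entropy nu * (size (f i y))%:R).
  apply: funext => i; rewrite /mean_production /production.
  rewrite (expectation_factor mu_gt0 alpha_iid A_prefix A_exhaustive A_nonnil i
    (g := fun y => entropy nu * (size (f i y))%:R)) //.
  by move=> y; rewrite mulr_ge0 // ltW.
rewrite meanC in m_littleo l_lim; rewrite meanP in l_lim.
move=> eps eps0.
have mE n : measurable [set w | eps < `|empirical_efficiency mu nu
    (serial_step A f) (serial_start Sigma) n (alpha w) - l|].
  exact: (measurable_prefix_event alpha_iid n (fun u => eps <
      `|(size (output (serial_step A f) (serial_start Sigma) u))%:R / n%:R *
        (entropy nu / entropy mu) - l|)).
apply/fine_cvgP; split.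
  by apply: nearW => n; apply: fin_num_measure.
apply/cvgrPdist_le => eta eta0.
have := efficiency_tail mu_gt0 Hmu_gt0 Hnu_gt0 alpha_iid A_prefix A_exhaustive
  A_nonnil size_f m_littleo l_lim eps0 eta0.
apply: filterS => n; rewrite sub0r normrN ger0_norm ?fine_ge0 //.
by rewrite -[X in (_ <= X)%R]/(fine eta%:E) => ?; apply: fine_le => //;
  apply: fin_num_measure.
Qed.
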